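(* (i) Let $n\geq 3$ and let $(\overline{c_1},\ldots,\overline{c_n})\in(\mathbb{Z}/2\mathbb{Z})^n$ be the quiddity of a $(3|4)$-dissection of a convex $n$-gon. Then $(\overline{c_1},\ldots,\overline{c_n})$ is a solution of $M(c_1,\ldots,c_n)\in\Gamma(2)$; that is, for all positive integers $c_1,\ldots,c_n$ whose classes modulo $2$ are $\overline{c_1},\ldots,\overline{c_n}$, one has $M(c_1,\ldots,c_n)\in\Gamma(2)$. (ii) Let $n\geq 3$ and let $(c_1,\ldots,c_n)$ be a sequence of positive integers such that $M(c_1,\ldots,c_n)\in\Gamma(2)$. Then the sequence $(\overline{c_1},\ldots,\overline{c_n})$ of classes modulo $2$ is the quiddity of some $(3|4)$-dissection of a convex $n$-gon.
   Context: For integers $c_1,\ldots,c_n$ put $$M(c_1,\ldots,c_n):=\begin{pmatrix} c_1 & -1\\ 1 & 0\end{pmatrix}\begin{pmatrix} c_2 & -1\\ 1 & 0\end{pmatrix}\cdots\begin{pmatrix} c_n & -1\\ 1 & 0\end{pmatrix}\in \mathrm{SL}(2,\mathbb{Z}).$$ $\Gamma(2)=\{A\in\mathrm{SL}(2,\mathbb{Z}) : A\equiv \mathrm{Id} \pmod 2\}$ is the principal congruence subgroup of level $2$. For an integer $a$, $\overline{a}:=a+2\mathbb{Z}\in\mathbb{Z}/2\mathbb{Z}$. Whether $M(c_1,\ldots,c_n)\in\Gamma(2)$ depends only on $(\overline{c_1},\ldots,\overline{c_n})$ and is invariant under cyclic rotation of the sequence. A $(3|4)$-dissection of a convex $n$-gon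 is a partition of the $n$-gon into sub-polygons by pairwise non-crossing diagonals such that every sub-polygon is a triangle or a quadrilateral (the set of diagonals may be empty when $n\in\{3,4\}$). Label the vertices of the $n$-gon $1,\ldots,n$ consecutively in cyclic order. The quiddity of a $(3|4)$-dissection is the (cyclically ordered) sequence $(\overline{c_1},\ldots,\overline{c_n})$ of elements of $\mathbb{Z}/2\mathbb{Z}$ such that $\overline{c_i}=\overline{1}$ if the number of triangles of the dissection adjacent to (i.e. having as a vertex) the $i$th vertex is odd, and $\overline{c_i}=\overline{0}$ if this number is even. *)

(* Defs.v *)
From mathcomp Require Import all_boot all_order all_algebra.

Set Implicit Arguments.
Unset Strict Implicit.
Unset Printing Implicit Defensive.

Import GRing.Theory Num.Theory.

Local Open Scope ring_scope.

Definition elem_mx (a : int) : 'M[int]_2 :=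
  \matrix_(i, j) nth 0 (nth [::] [:: [:: a; -1]; [:: 1; 0]] i) j.

Definition Mmx (n : nat) (c : 'I_n -> int) : 'M[int]_2 :=
  \prod_(i < n) elem_mx (c i).

Definition Gamma2 (A : 'M[int]_2) : Prop :=
  \det A = 1 /\ forall i j, (A i j = (1%:M : 'M[int]_2) i j %[mod 2])%Z.

Definition class2 (n : nat) (c : 'I_n -> int) : {ffun 'I_n -> 'Z_2} :=
  [ffun i => (c i)%:~R].

Local Open Scope nat_scope.

(* The vertices of the convex n-gon are the elements of 'I_n in cyclic order.
   A segment between two distinct vertices i < j is encoded as the pair (i, j),
   and a convex polygon inscribed in the n-gon as its set F of vertices. *)
Definition segment (n : nat) : Type := ('I_n * 'I_n)%type.

(* By convexity, e joins two cyclically consecutive vertices of F exactly when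
   one of the two open arcs determined by e contains no vertex of F. *)
Definition side (n : nat) (F : {set 'I_n}) (e : segment n) : bool :=
  [&& e.1 \in F, e.2 \in F, e.1 < e.2 &
      [forall k in F, ~~ (e.1 < k < e.2)] ||
      [forall k in F, e.1 <= k <= e.2]].

Definition diagonal (n : nat) (F : {set 'I_n}) (e : segment n) : bool :=
  [&& e.1 \in F, e.2 \in F, e.1 < e.2 & ~~ side F e].

Definition crossing (n : nat) (e f : segment n) : bool :=
  (e.1 < f.1 < e.2) && (e.2 < f.2) || (f.1 < e.1 < f.2) && (f.2 < e.2).

(* The polygons into which the n-gon is cut by a set D of pairwise non-crossing
   diagonals: those bounded by sides of the n-gon and elements of D, and not cut
   further by D.  As D is non-crossing, an element of D meeting the interior of
   such a polygon must be one of its diagonals. *)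
Definition subpolygons (n : nat) (D : {set segment n}) : {set {set 'I_n}} :=
  [set F : {set 'I_n} |
    [&& 2 < #|F|,
        [forall e, side F e ==> side setT e || (e \in D)] &
        [forall e, diagonal F e ==> (e \notin D)]]].

Definition dissection34 (n : nat) (D : {set segment n}) : Prop :=
  [/\ forall e, e \in D -> diagonal setT e,
      forall e f, e \in D -> f \in D -> ~~ crossing e f &
      forall F, F \in subpolygons D -> #|F| = 3 \/ #|F| = 4].

Definition triangles_at (n : nat) (D : {set segment n}) (i : 'I_n) :
    {set {set 'I_n}} :=
  [set F in subpolygons D | (#|F| == 3) && (i \in F)].

Definition quiddity (n : nat) (D : {set segment n}) : {ffun 'I_n -> 'Z_2} :=
  [ffun i => if odd #|triangles_at D i| then 1%R else 0%R].

Definition is_quiddity34 (n : nat) (cbar : {ffun 'I_n -> 'Z_2}) : Prop :=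
  exists D : {set segment n}, dissection34 D /\ quiddity D = cbar.

(* Main.v *)
Require Import Defs.
From mathcomp Require Import all_boot all_order all_algebra zify.

Set Implicit Arguments.
Unset Strict Implicit.
Unset Printing Implicit Defensive.

Import GRing.Theory Num.Theory.

(** Reducing entries modulo 2 turns the condition on M(c_1, ..., c_n) into the
    equation E(c_1) ... E(c_n) = 1 over Z/2Z, where E(z) is [emx z] (the
    determinant of M(c_1, ..., c_n) is always 1).  Three identities in
    SL(2, Z/2Z) govern this equation: E(0)^2 = 1, E(1)^3 = 1, and
    E(x + y) = E(x) E(0) E(y).

    The last one says that words can be cut along a diagonal.  Let a diagonal
    join vertices a < b of a polygon V, cutting it into the part V1 between a
    and b and the remaining part V2.  If c = c1 + c2 with c1 supported on V1
    and c2 on V2, then the letters of c at a and b factor through E(0), the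
    whole word of c1 along V1 appears as a factor of the word of c along V, and
    when it equals 1 the two adjacent factors E(0) cancel, so that the word of c
    along V is the word of c2 along V2 ([word_cut]).

    Dissections behave in the same way.  If D consists of the diagonal (a, b),
    a set D1 of diagonals of V1 and a set D2 of diagonals of V2, then the cells
    of D are those of D1 and those of D2 ([subpolygons_in_cut]), so that the
    numbers of triangles at each vertex add up ([triangle_parity_cut]).

    (i) The quiddity of a dissection has word 1, by induction on the number of
    vertices ([dissection_word]): cut along any of its diagonals; a dissection
    without diagonals is one triangle or one quadrilateral, with word E(1)^3 or
    E(0)^4.

    (ii) Conversely, let the word of c along V be 1 ([word1_dissection]).  If
    some vertex other than the first and the last one has c = 1, cut off the
    triangle formed by it and its two neighbours.  If not, E(x) E(0)^k E(y) = 1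
    forces c to vanish at the first and last vertices too, and V has an even
    number of vertices; cut off the quadrilateral formed by its first four
    vertices.  By [word_cut] the word along what remains is again 1, and
    [dissection_in_attach] glues the removed cell back.

    To run these inductions without renumbering vertices, polygons are arbitrary
    sets V of vertices of the fixed n-gon; the 2-gon, which has no cells and
    word E(0)^2 = 1, is a convenient starting point. *)

Local Open Scope nat_scope.

(** * Sides and cells of inscribed polygons *)

Section Polygons.

Variable n : nat.
Implicit Types (V F G : {set 'I_n}) (e f : segment n) (D : {set segment n}).

Lemma sideP F f :
  reflect [/\ f.1 \in F, f.2 \in F, f.1 < f.2 &
              (forall k, k \in F -> ~~ (f.1 < k < f.2)) \/
              (forall k, k \in F -> f.1 <= k <= f.2)]
          (side F f).
Proof.
apply: (iffP and4P) => [] [-> -> -> H]; split=> //.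
  by case/orP: H => /forall_inP; [left | right].
by apply/orP; case: H => H; [left | right]; apply/forall_inP.
Qed.

Lemma diagonalP F f :
  reflect [/\ f.1 \in F, f.2 \in F, f.1 < f.2 & ~~ side F f] (diagonal F f).
Proof. exact: and4P. Qed.

Lemma side_sub F V f :
  {subset F <= V} -> f.1 \in F -> f.2 \in F -> side V f -> side F f.
Proof.
move=> FV f1 f2 /sideP[_ _ f12 H]; apply/sideP; split=> //.
by case: H => H; [left | right] => k /FV/H.
Qed.

(** Consecutive elements of F around a cut v of the line bound a side of F.
    With [hull_side], which gives the side closing up the polygon, this produces
    all the sides needed below. *)
Lemma gap_side F v :
    (exists2 y, y \in F & y <= v) -> (exists2 z, z \in F & v < z) ->
  exists f, [/\ side F f, f.1 <= v < f.2 & forall k, k \in F -> ~~ (f.1 < k < f.2)].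
Proof.
case=> y yF yv [z zF vz].
have Py : (y \in F) && (y <= v) by rewrite yF.
have Pz : (z \in F) && (v < z) by rewrite zF.
case: (@arg_maxnP _ y (fun k => (k \in F) && (k <= v)) (fun k => k : nat) Py) => q /andP[qF qv] qmax.
case: (@arg_minnP _ z (fun k => (k \in F) && (v < k)) (fun k => k : nat) Pz) => r /andP[rF vr] rmin.
have gap k : k \in F -> ~~ (q < k < r).
  move=> kF; apply/negP=> /andP[qk kr].
  case: (leqP k v) => kv.
    by have := qmax k; rewrite kF kv => /(_ isT); lia.
  by have := rmin k; rewrite kF kv => /(_ isT); lia.
exists (q, r); split=> //=; last by rewrite qv.
by apply/sideP; split=> //=; [lia | left].
Qed.

Lemma hull_side F :
  1 < #|F| -> exists2 f, side F f & forall k, k \in F -> f.1 <= k <= f.2.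
Proof.
move=> /card_gt1P[y [z [yF zF yz]]].
case: (@arg_minnP _ y (mem F) (fun k => k : nat) yF) => q qF qmin.
case: (@arg_maxnP _ y (mem F) (fun k => k : nat) yF) => r rF rmax.
have hull k : k \in F -> q <= k <= r by move=> kF; apply/andP; split; [exact: qmin | exact: rmax].
exists (q, r) => //=.
apply/sideP; split=> //=; last by right.
rewrite ltnNge; apply/negP=> rq; case/negP: yz; apply/eqP/val_inj.
by move: (hull y yF) (hull z zF) => /=; lia.
Qed.

(** The cells of D in the polygon V instead of the whole n-gon; see
    [subpolygons_in_setT]. *)
Definition subpolygons_in V D : {set {set 'I_n}} :=
  [set F : {set 'I_n} |
    [&& F \subset V, 2 < #|F|,
        [forall e, side F e ==> side V e || (e \in D)] &
        [forall e, diagonal F e ==> (e \notin D)]]].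

Lemma subpolygons_inP V D F :
  reflect [/\ {subset F <= V}, 2 < #|F|,
              forall e, side F e -> side V e \/ e \in D &
              forall e, diagonal F e -> e \notin D]
          (F \in subpolygons_in V D).
Proof.
rewrite inE; apply: (iffP and4P).
  case=> /subsetP sFV -> /forallP Hs /forallP Hd; split=> // e He.
    by apply/orP; apply: (implyP (Hs e)).
  exact: (implyP (Hd e)).
case=> sFV -> Hs Hd; split=> //; first exact/subsetP.
  by apply/forallP=> e; apply/implyP=> /Hs/orP.
by apply/forallP=> e; apply/implyP=> /Hd.
Qed.

Lemma card_hull2 F f :
  (forall k, k \in F -> ~~ (f.1 < k < f.2)) ->
  (forall k, k \in F -> f.1 <= k <= f.2) -> #|F| <= 2.
Proof.
move=> gap hull; apply: leq_trans (_ : #|[set f.1; f.2]| <= 2).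
  apply/subset_leq_card/subsetP=> k kF; rewrite !inE -!val_eqE /=.
  by move: (gap k kF) (hull k kF); lia.
by rewrite cards2; case: (_ != _).
Qed.

(** A cell F of the empty dissection has only sides of V as sides.  A vertex v of
    V missing from F would lie strictly beyond a side of F, which being a side of
    V would then have all of V, hence all of F, on the side of v; this leaves F
    with only two vertices. *)
Lemma subpolygons_in0 V : 2 < #|V| -> subpolygons_in V set0 = [set V].
Proof.
move=> V3; apply/setP=> F; rewrite !inE; apply/idP/eqP; last first.
  move=> ->; rewrite subxx V3 /=.
  by apply/andP; split; apply/forallP=> e; apply/implyP=> He; rewrite ?He ?inE.
move=> HF; have /subpolygons_inP[sFV F3 Fside _] : F \in subpolygons_in V set0.
  by rewrite inE.
apply/setP=> v; apply/idP/idP; first exact: sFV.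
move=> vV; apply/negP=> /negP vF.
have Vside e : side F e -> (forall k, k \in V -> ~~ (e.1 < k < e.2)) \/
                (forall k, k \in V -> e.1 <= k <= e.2).
  by case/Fside => [/sideP[]//|]; rewrite inE.
have neq k : k \in F -> k != v :> nat.
  by move=> kF; rewrite (inj_eq val_inj); apply: contraNneq vF => <-.
have [h hs hull] := hull_side (ltnW F3).
case: (Vside h hs) => [gap|/(_ v vV) hv].
  by have := card_hull2 (fun k kF => gap k (sFV k kF)) hull; rewrite leqNgt F3.
have /sideP[h1 h2 _ _] := hs.
have [||f [fs fv gap]] := @gap_side F v.
- by exists h.1 => //; case/andP: hv.
- by exists h.2 => //; move: hv (neq _ h2); clear; lia.
have /sideP[f1 f2 _ _] := fs.
case: (Vside f fs) => [/(_ v vV)|hullf].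
  by move: fv (neq _ f1); clear; lia.
by have := card_hull2 gap (fun k kF => hullf k (sFV k kF)); rewrite leqNgt F3.
Qed.

(** * Cutting a polygon along a segment *)

Definition cut_in V e := [set k in V | e.1 <= k <= e.2].
Definition cut_out V e := [set k in V | ~~ (e.1 < k < e.2)].

Lemma cut_in_sub V e : {subset cut_in V e <= V}.
Proof. by move=> k; rewrite inE => /andP[]. Qed.
Lemma cut_out_sub V e : {subset cut_out V e <= V}.
Proof. by move=> k; rewrite inE => /andP[]. Qed.

Lemma cut_both V e f :
  e.1 < e.2 -> f.1 < f.2 -> f.1 \in cut_in V e -> f.2 \in cut_in V e ->
  f.1 \in cut_out V e -> f.2 \in cut_out V e -> f = e.
Proof.
case: e f => a b [c d] /= ab cd; rewrite !inE /= => /andP[_ H1] /andP[_ H2].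
move=> /andP[_ H3] /andP[_ H4].
by congr pair; apply: val_inj => /=; lia.
Qed.

Section Cut.

Variables (V : {set 'I_n}) (e : segment n).
Hypotheses (e1V : e.1 \in V) (e2V : e.2 \in V) (e12 : e.1 < e.2).

Local Notation V1 := (cut_in V e).
Local Notation V2 := (cut_out V e).

Lemma left_cut_in : e.1 \in V1. Proof. by rewrite inE e1V leqnn ltnW. Qed.
Lemma right_cut_in : e.2 \in V1. Proof. by rewrite inE e2V leqnn ltnW. Qed.
Lemma left_cut_out : e.1 \in V2. Proof. by rewrite inE e1V ltnn. Qed.
Lemma right_cut_out : e.2 \in V2. Proof. by rewrite inE e2V ltnn andbF. Qed.

Lemma cut_in_side : side V1 e.
Proof.
apply/sideP; split; rewrite ?left_cut_in ?right_cut_in //; right=> k.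
by rewrite inE => /andP[].
Qed.

Lemma cut_out_side : side V2 e.
Proof.
apply/sideP; split; rewrite ?left_cut_out ?right_cut_out //; left=> k.
by rewrite inE => /andP[].
Qed.

(** Cutting along e creates no other new side than e. *)
Lemma side_cut_in f : f.1 \in V1 -> f.2 \in V1 ->
  side V1 f <-> f = e \/ side V f.
Proof.
move=> f1 f2; split=> [/sideP[_ _ f12 [gap|hull]]|[->|fV]].
- right; apply/sideP; split; rewrite ?(cut_in_sub f1) ?(cut_in_sub f2) //.
  left=> k kV; apply/negP=> H.
  have kV1 : k \in V1 by move: f1 f2; rewrite !inE kV; lia.
  by have := gap k kV1; rewrite H.
- left; apply: (@cut_both V); rewrite ?inE //= ?(cut_in_sub f1) ?(cut_in_sub f2) //=;
  by move: (hull _ left_cut_in) (hull _ right_cut_in) f1 f2; rewrite !inE; lia.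
- exact: cut_in_side.
by apply: (side_sub (@cut_in_sub V e)).
Qed.

Lemma side_cut_out f : f.1 \in V2 -> f.2 \in V2 ->
  side V2 f <-> f = e \/ side V f.
Proof.
move=> f1 f2; split=> [/sideP[_ _ f12 H]|[->|fV]].
- have [->|fe] := eqVneq f e; [by left | right].
  have nfe : ~ (f.1 = e.1 :> nat /\ f.2 = e.2 :> nat).
    case=> H1 H2; case/eqP: fe; case: (f) (e) H1 H2 => [? ?] [? ?] /= H1 H2.
    by congr pair; apply: val_inj.
  apply/sideP; split; rewrite ?(cut_out_sub f1) ?(cut_out_sub f2) //.
  case: H => H; [left | right] => k kV; have [kV2|] := boolP (k \in V2);
    try (by apply: H); rewrite inE kV /= negbK => kab;
    move: (H _ left_cut_out) (H _ right_cut_out) f1 f2; rewrite !inE; lia.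
- exact: cut_out_side.
by apply: (side_sub (@cut_out_sub V e)).
Qed.

Lemma diagonal_cut_in f : diagonal V1 f -> diagonal V f.
Proof.
case/diagonalP=> f1 f2 f12 nf; apply/diagonalP; split=> //; rewrite ?(cut_in_sub f1) ?(cut_in_sub f2) //.
by apply: contra nf => sf; apply/side_cut_in => //; right.
Qed.

Lemma diagonal_cut_out f : diagonal V2 f -> diagonal V f.
Proof.
case/diagonalP=> f1 f2 f12 nf; apply/diagonalP; split=> //; rewrite ?(cut_out_sub f1) ?(cut_out_sub f2) //.
by apply: contra nf => sf; apply/side_cut_out => //; right.
Qed.

Lemma cutI_card F : {subset F <= V1} -> {subset F <= V2} -> #|F| <= 2.
Proof.
by move=> F1 F2; apply: (@card_hull2 F e) => k => [/F2|/F1]; rewrite inE => /andP[].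
Qed.

(** The endpoints of f lie in a common part, so that f does not cross e. *)
Definition unseparated e f :=
  (e.1 <= f.1 <= e.2) && (e.1 <= f.2 <= e.2) ||
  ~~ (e.1 < f.1 < e.2) && ~~ (e.1 < f.2 < e.2).

Lemma side_unseparated f : side V f -> unseparated e f.
Proof.
case/sideP=> f1 f2 f12 H; rewrite /unseparated.
by case: H => H; move: f12 e12 (H _ e1V) (H _ e2V); clear; lia.
Qed.

Lemma unseparated_in f : f.1 \in V1 -> f.2 \in V1 -> unseparated e f.
Proof. by rewrite !inE /unseparated => /andP[_ ->] /andP[_ ->]. Qed.

Lemma unseparated_out f : f.1 \in V2 -> f.2 \in V2 -> unseparated e f.
Proof. by rewrite !inE /unseparated => /andP[_ ->] /andP[_ ->]; rewrite orbT. Qed.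

(** Suppose F has a vertex x strictly between the endpoints of e and a vertex y
    outside, so that it lies in neither part.  The sides of F passing over either endpoint of e
    have to stop there, because they lead towards x and may not cross e; hence both
    endpoints belong to F, and x and y make e a diagonal of F. *)
Lemma cut_dichotomy F :
    1 < #|F| -> {subset F <= V} -> ~~ diagonal F e ->
    (forall f, side F f -> unseparated e f) ->
  {subset F <= V1} \/ {subset F <= V2}.
Proof.
move=> F2 FV ndiag Fside.
have [/subsetP|/subsetPn[y yF]] := boolP (F \subset V1); first by left.
have [/subsetP|/subsetPn[x xF]] := boolP (F \subset V2); first by right.
rewrite !inE !FV //= negbK => xe ye; case/negP: ndiag.
have [h hs hull] := hull_side F2.
have /sideP[h1 h2 _ _] := hs.
(* Otherwise the closing side of F would separate x from y. *)
have [hle hge] : h.1 <= e.1 /\ e.2 <= h.2.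
  by move: (hull x xF) (hull y yF) (Fside h hs) xe ye; rewrite /unseparated; clear; lia.
have [||f [fs fv fgap]] := @gap_side F e.1; first by exists h.1.
  by exists x => //; case/andP: xe.
(* The side arriving at e.2 from x is the one over the gap after e.2 - 1. *)
have [||g [gs gv ggap]] := @gap_side F e.2.-1.
- by exists x => //; move: xe; clear; lia.
- by exists h.2 => //; move: xe hge; clear; lia.
have /sideP[f1 f2 _ _] := fs; have /sideP[g1 g2 _ _] := gs.
have ef : e.1 = f.1.
  apply: val_inj => /=; move: (fgap x xF) (Fside f fs) fv xe.
  by rewrite /unseparated; clear; lia.
have eg : e.2 = g.2.
  apply: val_inj => /=; move: (ggap x xF) (Fside g gs) gv xe.
  by rewrite /unseparated; clear; lia.
apply/diagonalP; split=> //; [by rewrite ef | by rewrite eg |].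
apply/negP=> /sideP[_ _ _ [] H]; first by have := H x xF; rewrite xe.
by have := H y yF; rewrite (negPf ye).
Qed.

End Cut.

(** Sides of a cell are sides of V or elements of D, none of which crosses e, and
    e is not a diagonal of a cell, so [cut_dichotomy] puts each cell in one of the
    parts.  There the conditions defining cells for D and for D1 or D2 agree, since
    the parts share only the segment e, which is a side of both. *)
Lemma subpolygons_in_cut V e D1 D2 :
    diagonal V e ->
    (forall f, f \in D1 -> diagonal (cut_in V e) f) ->
    (forall f, f \in D2 -> diagonal (cut_out V e) f) ->
  subpolygons_in V (e |: (D1 :|: D2)) =
    subpolygons_in (cut_in V e) D1 :|: subpolygons_in (cut_out V e) D2.
Proof.
case/diagonalP=> e1 e2 e12 ne HD1 HD2.
apply/setP=> F; rewrite in_setU; apply/idP/orP.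
  move=> /subpolygons_inP[FV F3 Fs Fd].
  have [||||F1|F2] := @cut_dichotomy V e e12 F => //; first exact: ltnW.
  - by apply/negP=> /Fd; rewrite !inE eqxx.
  - move=> f /Fs[|]; first exact: side_unseparated.
    rewrite !inE => /orP[/eqP->|/orP[/HD1|/HD2] /diagonalP[f1 f2 _ _]].
    + exact: (@unseparated_in V e e (left_cut_in e1 e12) (right_cut_in e2 e12)).
    + exact: unseparated_in f1 f2.
    + exact: unseparated_out f1 f2.
  - left; apply/subpolygons_inP; split=> // f.
      move=> fs; have /sideP[/F1 f1 /F1 f2 f12 _] := fs.
      case: (Fs f fs) => [sV|].
        by left; apply/side_cut_in => //; right.
      rewrite !inE => /orP[/eqP->|/orP[->|/HD2/diagonalP[g1 g2 _ nf]]]; try by [right].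
        by left; apply: cut_in_side.
      have fe := cut_both e12 f12 f1 f2 g1 g2.
      by rewrite fe (cut_out_side e1 e2 e12) in nf.
    by move=> /Fd; apply: contra => fD; rewrite !inE fD !orbT.
  - right; apply/subpolygons_inP; split=> // f.
      move=> fs; have /sideP[/F2 f1 /F2 f2 f12 _] := fs.
      case: (Fs f fs) => [sV|].
        by left; apply/side_cut_out => //; right.
      rewrite !inE => /orP[/eqP->|/orP[/HD1/diagonalP[g1 g2 _ nf]|->]]; try by [right].
        by left; apply: cut_out_side.
      have fe := cut_both e12 f12 g1 g2 f1 f2.
      by rewrite fe (cut_in_side e1 e2 e12) in nf.
    by move=> /Fd; apply: contra => fD; rewrite !inE fD !orbT.
case=> /subpolygons_inP[FV F3 Fs Fd]; apply/subpolygons_inP; split=> //.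
- by move=> k /FV/cut_in_sub.
- move=> f fs; have /sideP[/FV f1 /FV f2 _ _] := fs.
  case: (Fs f fs) => [/side_cut_in|fD]; last by right; rewrite !inE fD orbT.
  by case=> // [->|]; [right; rewrite !inE eqxx | left].
- move=> f fd; have /diagonalP[/FV f1 /FV f2 f12 nf] := fd.
  rewrite !inE (negPf (Fd f fd)) /= negb_or; apply/andP; split.
    apply: contra nf => /eqP fe; have /diagonalP[g1 g2 _ _] := fd.
    by rewrite fe in g1 g2 *; apply: side_sub FV g1 g2 (cut_in_side e1 e2 e12).
  apply/negP=> /HD2/diagonalP[g1 g2 _].
  by rewrite (cut_both e12 f12 f1 f2 g1 g2) cut_out_side.
- by move=> k /FV/cut_out_sub.
- move=> f fs; have /sideP[/FV f1 /FV f2 _ _] := fs.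
  case: (Fs f fs) => [/side_cut_out|fD]; last by right; rewrite !inE fD !orbT.
  by case=> // [->|]; [right; rewrite !inE eqxx | left].
move=> f fd; have /diagonalP[/FV f1 /FV f2 f12 nf] := fd.
rewrite !inE (negPf (Fd f fd)) /= orbF negb_or; apply/andP; split.
  apply: contra nf => /eqP fe; have /diagonalP[g1 g2 _ _] := fd.
  by rewrite fe in g1 g2 *; apply: side_sub FV g1 g2 (cut_out_side e1 e2 e12).
apply/negP=> /HD1/diagonalP[g1 g2 _].
by rewrite (cut_both e12 f12 g1 g2 f1 f2) cut_in_side.
Qed.

(** * Dissections of inscribed polygons *)

Definition dissection_in V D : Prop :=
  [/\ forall e, e \in D -> diagonal V e,
      forall e f, e \in D -> f \in D -> ~~ crossing e f &
      forall F, F \in subpolygons_in V D -> #|F| = 3 \/ #|F| = 4].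

Lemma dissection_in0 V : #|V| = 3 \/ #|V| = 4 -> dissection_in V set0.
Proof.
move=> V34; split=> [e|e f|F]; [by rewrite inE | by rewrite inE |].
by rewrite subpolygons_in0 ?inE => [/eqP->|]; [|case: V34 => ->].
Qed.

Lemma dissection_in_cut V e D :
    dissection_in V D -> e \in D ->
  exists D1 D2, [/\ D = e |: (D1 :|: D2),
    dissection_in (cut_in V e) D1 & dissection_in (cut_out V e) D2].
Proof.
case=> Ddiag Dcross Dcell eD; have ed := Ddiag e eD.
have /diagonalP[e1 e2 e12 _] := ed.
set D1 := [set f in D | diagonal (cut_in V e) f].
set D2 := [set f in D | diagonal (cut_out V e) f].
have defD : D = e |: (D1 :|: D2).
  apply/setP=> f; rewrite !inE; apply/idP/idP; last first.
    by case/orP=> [/eqP->|/orP[]/andP[]].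
  move=> fD; rewrite fD /=; have [//|fe] /= := eqVneq f e.
  have /diagonalP[f1 f2 f12 nf] := Ddiag f fD.
  have [/andP[f1' f2']|/andP[f1' f2']] :
      (f.1 \in cut_in V e) && (f.2 \in cut_in V e) \/
      (f.1 \in cut_out V e) && (f.2 \in cut_out V e).
    rewrite !inE f1 f2 /=; move: (Dcross e f eD fD) e12 f12.
    by rewrite /crossing; clear; lia.
  - apply/orP; left; apply/diagonalP; split=> //; apply: contra nf.
    by move=> /side_cut_in[] // fe'; rewrite fe' eqxx in fe.
  - apply/orP; right; apply/diagonalP; split=> //; apply: contra nf.
    by move=> /side_cut_out[] // fe'; rewrite fe' eqxx in fe.
have D1diag f : f \in D1 -> diagonal (cut_in V e) f by rewrite inE => /andP[].
have D2diag f : f \in D2 -> diagonal (cut_out V e) f by rewrite inE => /andP[].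
have cells := subpolygons_in_cut ed D1diag D2diag; rewrite -defD in cells.
have subD (P : pred (segment n)) f g :
    f \in [set h in D | P h] -> g \in [set h in D | P h] -> ~~ crossing f g.
  by rewrite !inE => /andP[fD _] /andP[gD _]; apply: Dcross.
exists D1, D2; split=> //; split=> //; try exact: subD.
  by move=> F HF; apply: Dcell; rewrite cells inE HF.
by move=> F HF; apply: Dcell; rewrite cells inE HF orbT.
Qed.

Lemma dissection_in_glue V e D1 D2 :
    diagonal V e ->
    dissection_in (cut_in V e) D1 -> dissection_in (cut_out V e) D2 ->
  dissection_in V (e |: (D1 :|: D2)).
Proof.
move=> ed [D1diag D1cross D1cell] [D2diag D2cross D2cell].
have /diagonalP[e1 e2 e12 _] := ed.
have crossC f g : crossing f g = crossing g f by rewrite /crossing orbC.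
have in1 f : f \in D1 -> [&& e.1 <= f.1, f.1 < f.2 & f.2 <= e.2].
  by move=> /D1diag/diagonalP[]; rewrite !inE => /andP[_ /andP[-> _]] /andP[_ /andP[_ ->]] ->.
have in2 f : f \in D2 -> [&& ~~ (e.1 < f.1 < e.2), f.1 < f.2 & ~~ (e.1 < f.2 < e.2)].
  by move=> /D2diag/diagonalP[]; rewrite !inE => /andP[_ ->] /andP[_ ->] ->.
have ncross_ee : ~~ crossing e e by rewrite /crossing !ltnn !andbF.
have ncross_e1 f : f \in D1 -> ~~ crossing e f.
  by move=> /in1; move: e12; rewrite /crossing; clear; lia.
have ncross_e2 f : f \in D2 -> ~~ crossing e f.
  by move=> /in2; move: e12; rewrite /crossing; clear; lia.
have ncross_12 f g : f \in D1 -> g \in D2 -> ~~ crossing f g.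
  by move=> /in1 + /in2; move: e12; rewrite /crossing; clear; lia.
split=> [f|f g|F].
- rewrite !inE => /orP[/eqP->//|/orP[/D1diag|/D2diag]].
    exact: diagonal_cut_in.
  exact: diagonal_cut_out.
- rewrite !inE => /orP[/eqP->|/orP[fD|fD]] /orP[/eqP->|/orP[gD|gD]] //;
    by [apply: ncross_e1 | apply: ncross_e2 | rewrite crossC; apply: ncross_e1
       | rewrite crossC; apply: ncross_e2 | apply: D1cross | apply: D2cross
       | apply: ncross_12 | rewrite crossC; apply: ncross_12].
- by rewrite subpolygons_in_cut // inE => /orP[/D1cell|/D2cell].
Qed.

Lemma card_cut V e : diagonal V e ->
  #|cut_in V e| < #|V| /\ #|cut_out V e| < #|V|.
Proof.
move=> /diagonalP[e1 e2 e12 nside]; split; apply/proper_card.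
- rewrite properEneq; apply/andP; split; last by apply/subsetP/cut_in_sub.
  by apply: contra nside => /eqP <-; apply: cut_in_side.
- rewrite properEneq; apply/andP; split; last by apply/subsetP/cut_out_sub.
  by apply: contra nside => /eqP <-; apply: cut_out_side.
Qed.

Lemma card_gt1_lt V (x y : 'I_n) : x \in V -> y \in V -> x < y -> 1 < #|V|.
Proof.
move=> xV yV xy; apply/card_gt1P; exists x, y; split=> //.
by apply: contraTneq xy => ->; rewrite ltnn.
Qed.

Local Open Scope ring_scope.

(** * Parity of the number of triangles at a vertex *)

Definition triangle_parity V D (i : 'I_n) : 'Z_2 :=
  #|[set F in subpolygons_in V D | (#|F| == 3) && (i \in F)]|%:R.

Lemma triangle_parity_out V D i : i \notin V -> triangle_parity V D i = 0.
Proof.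
move=> iV; rewrite /triangle_parity; apply/eqP.
suff -> : [set F in subpolygons_in V D | (#|F| == 3) && (i \in F)] = set0 by rewrite cards0.
apply/setP=> F; rewrite !inE; apply/negP=> /andP[/andP[/subsetP FV _] /andP[_ /FV]].
exact/negP.
Qed.

Lemma triangle_parity_small V D i : (#|V| <= 2)%N -> triangle_parity V D i = 0.
Proof.
move=> V2; rewrite /triangle_parity; apply/eqP.
suff -> : [set F in subpolygons_in V D | (#|F| == 3) && (i \in F)] = set0 by rewrite cards0.
apply/setP=> F; rewrite !inE; apply/negP=> /andP[/andP[/subset_leq_card FV /andP[F3 _]] _].
by move: F3; rewrite ltnNge (leq_trans FV V2).
Qed.

Lemma triangle_parity0 V i : (2 < #|V|)%N ->
  triangle_parity V set0 i = ((#|V| == 3) && (i \in V))%:R.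
Proof.
move=> V3; rewrite /triangle_parity subpolygons_in0 //; congr (_%:R).
have [b|b] := boolP ((#|V| == 3) && (i \in V)).
  rewrite -[RHS](cards1 V); apply: eq_card => F; rewrite !inE.
  by case: eqP => // ->.
apply: eq_card0 => F; rewrite !inE.
by have [->|//] := eqVneq F V; rewrite (negPf b).
Qed.

(** Cells have at least three vertices and the two parts share only two, so no
    cell is counted twice. *)
Lemma triangle_parity_cut V e D1 D2 i :
    diagonal V e ->
    (forall f, f \in D1 -> diagonal (cut_in V e) f) ->
    (forall f, f \in D2 -> diagonal (cut_out V e) f) ->
  triangle_parity V (e |: (D1 :|: D2)) i =
    triangle_parity (cut_in V e) D1 i + triangle_parity (cut_out V e) D2 i.
Proof.
move=> ed HD1 HD2; rewrite /triangle_parity -natrD subpolygons_in_cut //.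
congr (_%:R); set A := subpolygons_in _ _; set B := subpolygons_in _ _.
have -> : [set F in A :|: B | (#|F| == 3) && (i \in F)] =
    [set F in A | (#|F| == 3) && (i \in F)] :|: [set F in B | (#|F| == 3) && (i \in F)].
  by apply/setP=> F; rewrite !inE andb_orl.
rewrite cardsU [X in (_ - X)%N](_ : _ = 0)%N ?subn0 //.
apply: eq_card0 => F; rewrite [LHS]in_setI [X in X && _]in_set [X in _ && X]in_set.
apply/negP=> /andP[/andP[/subpolygons_inP[F1 F3 _ _] _] /andP[/subpolygons_inP[F2 _ _ _] _]].
by have := cutI_card F1 F2; rewrite leqNgt F3.
Qed.

(** Attaching a triangle or quadrilateral along e to a dissected polygon.  When the
    rest is the 2-gon e, the attached cell is all of V and e is a side of V rather
    than a diagonal; covering this case spares [word1_dissection] the separate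
    treatment of triangles and quadrilaterals. *)
Lemma dissection_in_attach V e D2 :
    e.1 \in V -> e.2 \in V -> (e.1 < e.2)%N ->
    #|cut_in V e| = 3 \/ #|cut_in V e| = 4 ->
    dissection_in (cut_out V e) D2 ->
  exists2 D, dissection_in V D &
    forall i, triangle_parity V D i =
      ((#|cut_in V e| == 3) && (i \in cut_in V e))%:R +
      triangle_parity (cut_out V e) D2 i.
Proof.
move=> e1 e2 e12 V34 dis2.
have V1_3 : (2 < #|cut_in V e|)%N by case: V34 => ->.
have [sideV|nside] := boolP (side V e).
  have /sideP[_ _ _ [gap|hull]] := sideV.
    have /subset_leq_card : cut_in V e \subset [set e.1; e.2].
      apply/subsetP=> k; rewrite !inE -!val_eqE /= => /andP[/gap]; lia.
    by rewrite cards2 leqNgt (leq_trans _ V1_3) //; case: (_ != _).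
  have defV1 : cut_in V e = V.
    apply/setP=> k; rewrite inE; have [kV|//] := boolP (k \in V); exact: hull.
  exists set0; first by apply: dissection_in0; rewrite -defV1.
  have V2_2 : (#|cut_out V e| <= 2)%N.
    by apply: (@cutI_card V e) => // k /cut_out_sub; rewrite defV1.
  move=> i; rewrite (triangle_parity_small _ _ V2_2) addr0 defV1.
  by rewrite triangle_parity0 // -defV1.
have ed : diagonal V e by apply/diagonalP.
exists (e |: (set0 :|: D2)).
  by apply: dissection_in_glue => //; apply: dissection_in0.
move=> i; rewrite triangle_parity_cut // ?triangle_parity0 //.
  by move=> f; rewrite inE.
by case: dis2.
Qed.

End Polygons.

(** * Words in SL(2, Z/2Z) *)

Section Words.

Local Open Scope ring_scope.

(** The reduction modulo 2 of [elem_mx], see [emx_intr]. *)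
Definition emx (z : 'Z_2) : 'M['Z_2]_2 :=
  \matrix_(i, j) nth 0 (nth [::] [:: [:: z; -1]; [:: 1; 0]] i) j.

Lemma Z2_cases (z : 'Z_2) : z = 0 \/ z = 1.
Proof. by case: z => [[|[|//]] ?]; [left | right]; apply: val_inj. Qed.

Ltac emx_compute :=
  rewrite -?mulmxE; apply/matrixP; do 2![case=> [[|[|//]] ?]];
  rewrite !(mxE, big_ord_recl, big_ord0); exact: val_inj.

(** This is the matrix identity behind cutting: over the integers it holds up to a
    sign, which is invisible modulo 2. *)
Lemma emxD x y : emx (x + y) = emx x * emx 0 * emx y.
Proof. by case: (Z2_cases x) => ->; case: (Z2_cases y) => ->; emx_compute. Qed.

Lemma emx0_sqr : emx 0 * emx 0 = 1.
Proof. by emx_compute. Qed.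

Lemma emx1_cube : emx 1 * emx 1 * emx 1 = 1.
Proof. by emx_compute. Qed.

Variable n : nat.
Implicit Types (V : {set 'I_n}) (e : segment n) (c : 'I_n -> 'Z_2).

Lemma sorted_filter_ltn (s : seq 'I_n) v :
  sorted (fun i j : 'I_n => (i < j)%N) s ->
  s = [seq i : 'I_n <- s | (i < v)%N] ++ [seq i : 'I_n <- s | (v <= i)%N].
Proof.
elim: s => //= x s IHs xs; have [xv|vx] /= := ltnP x v.
  by rewrite -IHs // (path_sorted xs).
have xall i : i \in s -> (v <= i)%N.
  move=> si; apply: leq_trans vx (ltnW _); move: i si; apply/allP.
  by apply: order_path_min xs => i j k; apply: ltn_trans.
rewrite (eq_in_filter (a2 := pred0)) ?filter_pred0 /=; last first.
  by move=> i /xall; rewrite ltnNge => ->.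
by rewrite (eq_in_filter (a2 := predT)) ?filter_predT // => i /xall.
Qed.

(** Products over 'I_n follow the order of the vertices, hence split at any v even
    though the ring is noncommutative. *)
Lemma prod_ltn_split (R : pzRingType) (P : pred 'I_n) (G : 'I_n -> R) v :
  \prod_(i | P i) G i =
  \prod_(i | P i && (i < v)%N) G i * \prod_(i | P i && (v <= i)%N) G i.
Proof.
have srt : sorted (fun i j : 'I_n => (i < j)%N) (index_enum 'I_n).
  have := iota_ltn_sorted 0 n; rewrite -val_enum_ord sorted_map enumT /index_enum.
  by rewrite unlock.
rewrite {1}(sorted_filter_ltn v srt) big_cat /= !big_filter_cond.
by congr (_ * _); apply: eq_bigl => i; rewrite andbC.
Qed.

Lemma prod_two_split (R : pzRingType) V (G : 'I_n -> R) e :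
    e.1 \in V -> e.2 \in V -> (e.1 < e.2)%N ->
  \prod_(i in V) G i =
    \prod_(i in V | (i < e.1)%N) G i * (G e.1 *
      (\prod_(i in V | (e.1 < i < e.2)%N) G i * (G e.2 *
        \prod_(i in V | (e.2 < i)%N) G i))).
Proof.
move=> e1 e2 e12.
have pick (k : 'I_n) (P : pred 'I_n) : P =1 pred1 k -> \prod_(i | P i) G i = G k.
  by move=> Pk; rewrite (eq_bigl _ _ Pk) big_pred1_eq.
rewrite (prod_ltn_split _ _ e.1); congr (_ * _).
rewrite (prod_ltn_split _ _ e.1.+1); congr (_ * _).
  apply: pick => i; have [->|ie] := eqVneq i e.1.
    by rewrite /= e1 eqxx leqnn ltnS leqnn.
  rewrite /= (negPf ie); apply/negbTE; move: ie; rewrite -val_eqE /=; clear.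
  by case: (i \in V) => //=; lia.
rewrite (prod_ltn_split _ _ e.2); congr (_ * _).
  by apply: eq_bigl => i; case: (i \in V) => //=; move: e12; clear; lia.
rewrite (prod_ltn_split _ _ e.2.+1); congr (_ * _).
  apply: pick => i; have [->|ie] := eqVneq i e.2.
    by rewrite /= e2 eqxx; move: e12; clear; lia.
  rewrite /= (negPf ie); apply/negbTE; move: ie; rewrite -val_eqE /=; clear.
  by case: (i \in V) => //=; lia.
by apply: eq_bigl => i; case: (i \in V) => //=; move: e12; clear; lia.
Qed.

(** Both endpoint factors of G split through the involution S, in such an order
    that the whole product of G1 over [cut_in V e] appears between the two S; when
    it is 1 they meet and cancel. *)
Lemma prod_cut (R : pzRingType) V e (G G1 G2 : 'I_n -> R) (S : R) :
    e.1 \in V -> e.2 \in V -> (e.1 < e.2)%N -> S * S = 1 ->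
    (forall i, i \in V -> (e.1 < i < e.2)%N -> G i = G1 i) ->
    (forall i, i \in V -> ~~ (e.1 <= i <= e.2)%N -> G i = G2 i) ->
    G e.1 = G2 e.1 * S * G1 e.1 -> G e.2 = G1 e.2 * S * G2 e.2 ->
    \prod_(i in cut_in V e) G1 i = 1 ->
  \prod_(i in V) G i = \prod_(i in cut_out V e) G2 i.
Proof.
move=> e1 e2 e12 S2 Gin Gout Ge1 Ge2.
rewrite (prod_two_split _ e1 e2 e12) (prod_two_split _ (left_cut_in e1 e12) (right_cut_in e2 e12) e12).
rewrite (prod_two_split _ (left_cut_out e1) (right_cut_out e2) e12).
rewrite (@big_pred0 _ _ _ _ _ (fun i => (i \in cut_in V e) && (i < e.1)%N)); last first.
  by move=> i; rewrite inE; case: (i \in V) => //=; clear; lia.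
rewrite (@big_pred0 _ _ _ _ _ (fun i => (i \in cut_in V e) && (e.2 < i)%N)); last first.
  by move=> i; rewrite inE; case: (i \in V) => //=; clear; lia.
rewrite (@big_pred0 _ _ _ _ _ (fun i => (i \in cut_out V e) && (e.1 < i < e.2)%N)); last first.
  by move=> i; rewrite inE; case: (i \in V) => //=; clear; lia.
have -> : \prod_(i in cut_in V e | (e.1 < i < e.2)%N) G1 i =
          \prod_(i in V | (e.1 < i < e.2)%N) G i.
  apply: eq_big => i; first by rewrite inE; case: (i \in V) => //=; clear; lia.
  by rewrite inE => /andP[/andP[iV _] ie]; rewrite Gin.
have -> : \prod_(i in cut_out V e | (i < e.1)%N) G2 i = \prod_(i in V | (i < e.1)%N) G i.
  apply: eq_big => i; first by rewrite inE; case: (i \in V) => //=; clear; lia.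
  by rewrite inE => /andP[/andP[iV _] ie]; rewrite Gout //; move: ie; clear; lia.
have -> : \prod_(i in cut_out V e | (e.2 < i)%N) G2 i = \prod_(i in V | (e.2 < i)%N) G i.
  apply: eq_big => i; first by rewrite inE; case: (i \in V) => //=; clear; lia.
  by rewrite inE => /andP[/andP[iV _] ie]; rewrite Gout //; move: ie; clear; lia.
set A := \prod_(i in V | (i < e.1)%N) G i; set B := \prod_(i in V | (e.2 < i)%N) G i.
set M := \prod_(i in V | _) G i; rewrite mul1r mulr1 mul1r => M1.
congr (_ * _); rewrite Ge1 Ge2.
transitivity (G2 e.1 * S * (G1 e.1 * (M * G1 e.2)) * S * G2 e.2 * B).
  by rewrite !mulrA.
by rewrite M1 mulr1 -[_ * S * S]mulrA S2 mulr1 mulrA.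
Qed.

Definition word V c := \prod_(i in V) emx (c i).

Lemma eq_word V c c' : {in V, c =1 c'} -> word V c = word V c'.
Proof. by move=> eqc; apply: eq_bigr => i iV; rewrite eqc. Qed.

Lemma word_const V c z : {in V, forall i, c i = z} -> word V c = emx z ^+ #|V|.
Proof. by move=> cz; rewrite -prodr_const; apply: eq_bigr => i iV; rewrite cz. Qed.

Lemma word_cut V e c c1 c2 :
    e.1 \in V -> e.2 \in V -> (e.1 < e.2)%N ->
    {in V, forall i, c i = c1 i + c2 i} ->
    {in V, forall i, i \notin cut_in V e -> c1 i = 0} ->
    {in V, forall i, i \notin cut_out V e -> c2 i = 0} ->
    word (cut_in V e) c1 = 1 ->
  word V c = word (cut_out V e) c2.
Proof.
move=> e1 e2 e12 cD c1_0 c2_0; apply: (prod_cut e1 e2 e12 emx0_sqr).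
- by move=> i iV ie; rewrite cD // c2_0 ?addr0 // inE ie andbF.
- by move=> i iV ie; rewrite cD // c1_0 ?add0r // inE (negPf ie) andbF.
- by rewrite cD // addrC emxD.
- by rewrite cD // emxD.
Qed.

(** The lower right entry of E(x) is 0. *)
Lemma emx_neq1 x : emx x <> 1.
Proof.
by move=> /matrixP/(_ 1 1); rewrite !mxE.
Qed.

Lemma emx_mul_eq1 x y : emx x * emx y = 1 -> x = 0 /\ y = 0.
Proof.
rewrite -mulmxE => /matrixP E; move: (E 0 1) (E 1 0).
rewrite !(mxE, big_ord_recl, big_ord0) /=.
by case: (Z2_cases x) => ->; case: (Z2_cases y) => ->.
Qed.

Lemma emx0_exp k : emx 0 ^+ k = if odd k then emx 0 else 1.
Proof.
elim: k => // k IHk; rewrite exprS IHk /=.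
by case: (odd k); rewrite ?mulr1 ?emx0_sqr.
Qed.

(** The word is E(x) E(0)^k E(y).  For odd k it equals E(x + y), which is never 1;
    for even k it is E(x) E(y), whose off-diagonal entries are x and y up to sign. *)
Lemma word_interior0 V e c :
    e.1 \in V -> e.2 \in V -> (e.1 < e.2)%N ->
    (forall k, k \in V -> (e.1 <= k <= e.2)%N) ->
    (forall k, k \in V -> (e.1 < k < e.2)%N -> c k = 0) ->
  word V c = 1 -> {in V, forall k, c k = 0}.
Proof.
move=> e1 e2 e12 hull c0; rewrite /word (prod_two_split _ e1 e2 e12).
rewrite big_pred0 ?mul1r; last first.
  by move=> i; have [/hull|//] := boolP (i \in V); clear; lia.
rewrite [X in _ * (_ * (_ * X))]big_pred0 ?mulr1; last first.
  by move=> i; have [/hull|//] := boolP (i \in V); clear; lia.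
rewrite (eq_bigr (fun=> emx 0)); last by move=> i /andP[iV ie]; rewrite c0.
rewrite prodr_const emx0_exp => W1.
have [c1 c2] : c e.1 = 0 /\ c e.2 = 0.
  apply: emx_mul_eq1; case: odd W1; last by rewrite mul1r.
  by rewrite mulrA -emxD => /emx_neq1.
move=> k kV; have [->//|k1] := eqVneq k e.1; have [->//|k2] := eqVneq k e.2.
by apply: c0 => //; move: k1 k2 (hull k kV); rewrite -!val_eqE /=; clear; lia.
Qed.

(** * From dissections to solutions *)

Lemma dissection_word V D :
  (1 < #|V|)%N -> dissection_in V D -> word V (triangle_parity V D) = 1.
Proof.
have [m] := ubnP #|V|; elim: m V D => // m IHm V D Vm V2 dis.
have [D0|[e eD]] := set_0Vmem D.
  rewrite D0 in dis *; have [V3|V3] := ltnP 2 #|V|; last first.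
    rewrite (@word_const _ _ 0) => [|i _]; last exact: triangle_parity_small.
    have -> : #|V| = 2 by apply/eqP; rewrite eqn_leq V3.
    by rewrite emx0_exp.
  rewrite (@word_const _ _ (#|V| == 3)%:R) => [|i iV]; last first.
    by rewrite triangle_parity0 // iV andbT.
  case: dis => _ _ /(_ V); rewrite subpolygons_in0 // set11.
  by case=> // -> /=; rewrite ?emx0_exp // !exprS expr0 mulr1 mulrA emx1_cube.
have ed : diagonal V e by case: dis => H _ _; apply: H.
have /diagonalP[e1 e2 e12 _] := ed.
have [D1 [D2 [defD dis1 dis2]]] := dissection_in_cut dis eD.
have [card1 card2] := card_cut ed.
rewrite (@word_cut V e _ (triangle_parity (cut_in V e) D1)
                         (triangle_parity (cut_out V e) D2)) //.
- apply: IHm dis2; first exact: leq_trans card2 Vm.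
  exact: card_gt1_lt (left_cut_out e1) (right_cut_out e2) e12.
- by move=> i _; rewrite defD triangle_parity_cut //; [case: dis1 | case: dis2].
- by move=> i _; apply: triangle_parity_out.
- by move=> i _; apply: triangle_parity_out.
- apply: IHm dis1; first exact: leq_trans card1 Vm.
  exact: card_gt1_lt (left_cut_in e1 e12) (right_cut_in e2 e12) e12.
Qed.

(** * From solutions to dissections *)

Lemma Z2_addrr (z : 'Z_2) : z + z = 0.
Proof. by case: (Z2_cases z) => ->; apply: val_inj. Qed.

Lemma natr_Z2 m : m%:R = (odd m)%:R :> 'Z_2.
Proof.
elim: m => // m IHm; rewrite mulrS IHm /=.
by case: (odd m); rewrite ?addr0 // Z2_addrr.
Qed.

(** Removing the cell cut off by e.  A triangle lowers c by 1 at its three vertices,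
    a quadrilateral leaves c unchanged; the condition on c between
    the endpoints of e makes the result vanish at the removed
    vertices, and the constant word of the removed cell is E(1)^3 or E(0)^4. *)
Lemma word1_dissection_step V c e :
    e.1 \in V -> e.2 \in V -> (e.1 < e.2)%N ->
    #|cut_in V e| = 3 \/ #|cut_in V e| = 4 ->
    (forall i, i \in V -> (e.1 < i < e.2)%N -> c i = (#|cut_in V e| == 3)%:R) ->
    (forall c2, word (cut_out V e) c2 = 1 ->
       exists2 D, dissection_in (cut_out V e) D &
         {in cut_out V e, triangle_parity (cut_out V e) D =1 c2}) ->
    word V c = 1 ->
  exists2 D, dissection_in V D & {in V, triangle_parity V D =1 c}.
Proof.
move=> e1 e2 e12 V34 cin IH W1.
pose c1 i : 'Z_2 := ((#|cut_in V e| == 3) && (i \in cut_in V e))%:R.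
pose c2 i := c1 i + c i.
have cD : {in V, forall i, c i = c1 i + c2 i}.
  by move=> i _; rewrite addrA Z2_addrr add0r.
have c2_0 : {in V, forall i, i \notin cut_out V e -> c2 i = 0}.
  move=> i iV; rewrite inE iV /= negbK => ie.
  have iV1 : i \in cut_in V e by rewrite inE iV; move: ie; clear; lia.
  by rewrite /c2 /c1 iV1 andbT cin // Z2_addrr.
have W2 : word (cut_out V e) c2 = 1.
  rewrite -W1; apply/esym/(word_cut e1 e2 e12 cD _ c2_0) => [i _ /negPf iV1|].
    by rewrite /c1 iV1 andbF.
  rewrite (@word_const _ _ (#|cut_in V e| == 3)%:R) => [|i iV1]; last first.
    by rewrite /c1 iV1 andbT.
  case: V34 => -> /=; last by rewrite emx0_exp.
  by rewrite !exprS expr0 mulr1 mulrA emx1_cube.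
have [D2 dis2 tpD2] := IH c2 W2.
have [D dis tpD] := dissection_in_attach e1 e2 e12 V34 dis2.
exists D => // i iV; rewrite tpD cD //; congr (_ + _).
have [iV2|iV2] := boolP (i \in cut_out V e); first exact: tpD2.
by rewrite triangle_parity_out // c2_0.
Qed.

Lemma word1_dissection V c : (1 < #|V|)%N -> word V c = 1 ->
  exists2 D, dissection_in V D & {in V, triangle_parity V D =1 c}.
Proof.
have [m] := ubnP #|V|; elim: m V c => // m IHm V c Vm V2 W1.
have step e : e.1 \in V -> e.2 \in V -> (e.1 < e.2)%N ->
    #|cut_in V e| = 3 \/ #|cut_in V e| = 4 ->
    (forall i, i \in V -> (e.1 < i < e.2)%N -> c i = (#|cut_in V e| == 3)%:R) ->
    exists2 D, dissection_in V D & {in V, triangle_parity V D =1 c}.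
  move=> e1 e2 e12 V34 cin; apply: (word1_dissection_step e1 e2 e12 V34 cin _ W1) => c2.
  apply: IHm; last exact: card_gt1_lt (left_cut_out e1) (right_cut_out e2) e12.
  suff card2 : (#|cut_out V e| < #|V|)%N by exact: leq_trans card2 Vm.
  apply/proper_card; rewrite properEneq; apply/andP; split; last by apply/subsetP/cut_out_sub.
  apply/negP=> /eqP V2V.
  have : (#|cut_in V e| <= 2)%N.
    by apply: (@cutI_card _ V e) => k // /cut_in_sub; rewrite V2V.
  by case: V34 => ->.
have [h hs hull] := hull_side V2; have /sideP[h1 h2 h12 _] := hs.
have next (x : 'I_n) : x \in V -> (exists2 z, z \in V & (x < z)%N) ->
    exists y, [/\ y \in V, (x < y)%N & forall k, k \in V -> (k <= x)%N || (y <= k)%N].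
  move=> xV xz; have [|f [/sideP[f1 f2 f12 _] fx gap]] := gap_side _ xz; first by exists x.
  by exists f.2; split=> // [|k kV]; move: fx; last move: (gap k kV) (gap x xV); clear; lia.
(* If c x = 1 for an inner vertex x, cut off x with its two neighbours. *)
have [/exists_inP[x xV /andP[/andP[hx xh] cx]]|] :=
    boolP [exists (x | x \in V), (h.1 < x < h.2)%N && (c x != 0)].
  have [||f [/sideP[f1 f2 f12 _] fx fgap]] := @gap_side n V x.-1.
  - by exists h.1 => //; move: hx; clear; lia.
  - by exists x => //; move: hx; clear; lia.
  have [|y [yV xy ygap]] := next x xV; first by exists h.2.
  have fx' : (f.1 < x)%N by move: fx hx; clear; lia.
  have V1E : cut_in V (f.1, y) = [set f.1; x; y].
    apply/setP=> k; rewrite !inE -!val_eqE /=; have [kV|kV] := boolP (k \in V).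
      by move: (fgap k kV) (ygap k kV) (fgap x xV) fx fx' xy; clear; lia.
    apply/esym/negbTE; apply: contra kV.
    by rewrite !(inj_eq val_inj) => /orP[/orP[]|] /eqP->.
  have V1_3 : #|cut_in V (f.1, y)| = 3.
    rewrite V1E -setUA !cardsU1 cards1 !inE -!val_eqE /=; move: fx' xy; clear; lia.
  apply: (step (f.1, y)) => //=; [exact: ltn_trans xy | by left |].
  move=> i iV ie; rewrite V1_3 /=.
  have : i \in cut_in V (f.1, y) by rewrite inE iV /=; move: ie; clear; lia.
  rewrite V1E !inE => ix; have -> : i = x.
    by apply: val_inj; move: ix ie; rewrite -!val_eqE /=; clear; lia.
  by case: (Z2_cases (c x)) cx => -> //; rewrite eqxx.
(* If not, c vanishes on V: cut off the first four vertices h.1, x, y, b. *)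
rewrite negb_exists_in => /forall_inP c0.
have {}c0 : {in V, forall k, c k = 0}.
  apply: word_interior0 h1 h2 h12 hull _ W1 => k kV hk.
  by have := c0 k kV; rewrite hk negbK => /eqP.
(* E(0)^3 = E(0) is not 1, so V is either the 2-gon or has at least four vertices. *)
have V3 : #|V| != 3.
  apply/eqP=> V3; move: W1; rewrite (word_const c0) V3 emx0_exp; exact: emx_neq1.
have [V4|V4] := leqP 4 #|V|; last first.
  have {}V2 : #|V| = 2 by move: V2 V3 V4; clear; lia.
  have small F D : F \in subpolygons_in V D -> False.
    by move=> /subpolygons_inP[/subsetP/subset_leq_card]; rewrite V2 leqNgt => /negP.
  exists set0 => [|i iV]; last by rewrite triangle_parity_small ?V2 // c0.
  by split=> [f|f g|F /small//]; rewrite inE.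
have more (s : seq 'I_n) : (size s < 4)%N -> exists2 z, z \in V & z \notin s.
  move=> s4; apply/subsetPn; apply: contraL V4 => /subset_leq_card Vs.
  by rewrite -ltnNge (leq_ltn_trans Vs) // (leq_ltn_trans (card_size s)).
have [|x [xV hx xgap]] := next h.1 h1; first by exists h.2.
have [|y [yV xy ygap]] := next x xV.
  have [z zV] := more [:: h.1; x] isT; rewrite !inE -!val_eqE /= => zs.
  by exists z => //; move: (xgap z zV) (hull z zV) zs; clear; lia.
have [|b [bV yb bgap]] := next y yV.
  have [z zV] := more [:: h.1; x; y] isT; rewrite !inE -!val_eqE /= => zs.
  by exists z => //; move: (xgap z zV) (ygap z zV) (hull z zV) zs; clear; lia.
have V1E : cut_in V (h.1, b) = [set h.1; x; y; b].
  apply/setP=> k; rewrite !inE -!val_eqE /=; have [kV|kV] := boolP (k \in V).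
    by move: (xgap k kV) (ygap k kV) (bgap k kV) (hull k kV) hx xy yb; clear; lia.
  apply/esym/negbTE; apply: contra kV.
  by rewrite !(inj_eq val_inj) => /orP[/orP[/orP[]|]|] /eqP->.
have V1_4 : #|cut_in V (h.1, b)| = 4.
  rewrite V1E -!setUA !cardsU1 cards1 !inE -!val_eqE /=; move: hx xy yb; clear; lia.
apply: (step (h.1, b)) => //=; first by move: hx xy yb; clear; lia.
  by right.
by move=> i iV _; rewrite c0 // V1_4.
Qed.

(** * Reduction modulo 2 and the whole n-gon *)

Lemma emx_intr (a : int) : emx a%:~R = map_mx intr (elem_mx a).
Proof.
apply/matrixP; do 2![case=> [[|[|//]] ?]]; rewrite !mxE //=.
Qed.

Lemma word_class2 (c : 'I_n -> int) : word setT (class2 c) = map_mx intr (Mmx c).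
Proof.
rewrite /Mmx rmorph_prod; apply: eq_big => [i|i _]; first by rewrite inE.
by rewrite ffunE emx_intr.
Qed.

Lemma det_Mmx (c : 'I_n -> int) : \det (Mmx c) = 1.
Proof.
rewrite /Mmx; apply: (big_ind (fun A => \det A = 1)) => [|A B dA dB|i _].
- exact: det1.
- by rewrite -mulmxE det_mulmx dA dB mulr1.
- by rewrite (expand_det_row _ ord0) !big_ord_recl big_ord0 /cofactor !det_mx11 !mxE /= !mulr0 add0r.
Qed.

Lemma intr_Z2_eq (a b : int) : (a%:~R = b%:~R :> 'Z_2) <-> (a = b %[mod 2])%Z.
Proof.
have ch : 2%N \in [pchar 'Z_2] by rewrite inE /=; apply/eqP/val_inj.
split=> [ab|/eqP].
  apply/eqP; rewrite eqz_mod_dvd (dvdz_pcharf ch).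
  by rewrite rmorphB /= ab subrr.
by rewrite eqz_mod_dvd (dvdz_pcharf ch) rmorphB /= subr_eq0 => /eqP.
Qed.

Lemma Gamma2_word (c : 'I_n -> int) : Gamma2 (Mmx c) <-> word setT (class2 c) = 1.
Proof.
rewrite word_class2; split=> [[_ M2]|M1].
  apply/matrixP=> i j; rewrite mxE; have /intr_Z2_eq -> := M2 i j.
  by rewrite !mxE; case: (i == j).
split=> [|i j]; first exact: det_Mmx.
apply/intr_Z2_eq; move/matrixP/(_ i j): M1; rewrite mxE => ->.
by rewrite !mxE; case: (i == j).
Qed.

End Words.

Section WholePolygon.

Local Open Scope ring_scope.

Variable n : nat.

Lemma subpolygons_in_setT (D : {set segment n}) : subpolygons_in setT D = subpolygons D.
Proof. by apply/setP=> F; rewrite !inE subsetT. Qed.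

Lemma dissection_in_setT (D : {set segment n}) : dissection_in setT D <-> dissection34 D.
Proof. by rewrite /dissection_in subpolygons_in_setT. Qed.

Lemma triangle_parity_setT (D : {set segment n}) i :
  triangle_parity setT D i = quiddity D i.
Proof.
rewrite ffunE /triangle_parity subpolygons_in_setT -/(triangles_at D i).
by rewrite natr_Z2; case: odd.
Qed.

End WholePolygon.

Local Open Scope ring_scope.

Theorem theorem3p5 (n : nat) (hn : (3 <= n)%N) :
  (forall cbar : {ffun 'I_n -> 'Z_2}, is_quiddity34 cbar ->
     forall c : 'I_n -> int, (forall i, 0 < c i) -> class2 c = cbar ->
     Gamma2 (Mmx c))
  /\
  (forall c : 'I_n -> int, (forall i, 0 < c i) -> Gamma2 (Mmx c) ->
     is_quiddity34 (class2 c)).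
Proof.
have n2 : (1 < #|[set: 'I_n]|)%N by rewrite cardsT card_ord ltnW.
split=> [_ [D [/dissection_in_setT dis <-]] c _ cE|c _ /Gamma2_word W1].
  apply/Gamma2_word; rewrite -(dissection_word n2 dis).
  by apply: eq_word => i _; rewrite cE triangle_parity_setT.
have [D /dissection_in_setT dis tpD] := word1_dissection n2 W1.
exists D; split=> //; apply/ffunP=> i.
by rewrite -triangle_parity_setT tpD ?inE.
Qed.
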